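(* Let $X_1,\dots,X_n$ be independent real random variables with continuous cumulative distribution functions $F_1,\dots,F_n$, and let $X^{(1)}\ge\cdots\ge X^{(n)}$ be their order statistics. Let $F_N(x)=\frac1n\sum_{k=1}^n F_k(x)$ and $F_N^{-1}(q)=\inf\{x\in\mathbb{R}: F_N(x)\ge q\}$ for $q\in(0,1)$. For any $p\in(0,1)$ such that $pn\ge 1$ and $t>0$, denote $$\varphi_F^+(t)=\frac{\lfloor pn\rfloor}{n}+F_N\big(F_N^{-1}(1-p)+t\big)-1,\qquad \varphi_F^-(t)=\frac{\lfloor pn\rfloor}{n}+F_N\big(F_N^{-1}(1-p)-t\big)-1.$$ Then, for all $t>0$ such that $\varphi_F^+(t)\ge 0$, $$\mathbb{P}\big(X^{(\lfloor pn\rfloor)}\ge F_N^{-1}(1-p)+t\big)\le \exp\Big(-2n\,[\varphi_F^+(t)]^2\Big).$$ Similarly, for all $t>0$, $$\mathbb{P}\big(X^{(\lfloor pn\rfloor)}\le F_N^{-1}(1-p)-t\big)\le \exp\Big(-2n\,[\varphi_F^-(t)]^2\Big).$$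
   Context: The random variables $X_1,\dots,X_n$ are independent but not necessarily identically distributed; $F_k(x)=\mathbb{P}(X_k\le x)$. The order statistics are in decreasing order: $X^{(j)}$ is the $j$-th largest of $X_1,\dots,X_n$. $\lfloor\cdot\rfloor$ is the floor function. The random variable $X^{(\lfloor pn\rfloor)}$ is called the $100(1-p)$%-th percentile. The subscript $N$ in $F_N$ is just notation; the number of variables is $n$. *)

(* Defs.v *)
From HB Require Import structures.
From mathcomp Require Import all_boot all_order all_algebra.
From mathcomp Require Import all_classical all_reals all_analysis.

Set Implicit Arguments.
Unset Strict Implicit.
Unset Printing Implicit Defensive.

Import Order.TTheory GRing.Theory Num.Theory.
Import numFieldNormedType.Exports.

Local Open Scope classical_set_scope.
Local Open Scope ring_scope.

Definition independent_RVs (d : measure_display) (T : measurableType d)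
    (R : realType) (P : probability T R) (n : nat)
    (X : 'I_n -> {RV P >-> R}) : Prop :=
  forall (J : {set 'I_n}) (B : 'I_n -> set R),
    (forall i, i \in J -> measurable (B i)) ->
    P (\bigcap_(i in [set` J]) (X i @^-1` B i)) =
    (\prod_(i in J) P (X i @^-1` B i))%E.

(* The j-th largest value, for 1 <= j <= n; outside this range the value is
   meaningless. *)
Definition order_stat (d : measure_display) (T : measurableType d)
    (R : realType) (P : probability T R) (n : nat)
    (X : 'I_n -> {RV P >-> R}) (j : nat) (w : T) : R :=
  nth 0 (sort >=%R [seq X k w | k <- enum 'I_n]) j.-1.

Definition mean_cdf (d : measure_display) (T : measurableType d)
    (R : realType) (P : probability T R) (n : nat)
    (X : 'I_n -> {RV P >-> R}) (x : R) : R :=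
  n%:R^-1 * \sum_(k < n) fine (cdf (X k) x).

(* For n > 0 and 0 < q < 1 the set below is nonempty and bounded from below,
   so that inf is a genuine infimum and not its default value 0. *)
Definition mean_quantile (d : measure_display) (T : measurableType d)
    (R : realType) (P : probability T R) (n : nat)
    (X : 'I_n -> {RV P >-> R}) (q : R) : R :=
  inf [set x : R | q <= mean_cdf X x].

(* On nonnegative reals Num.truncn is the nat-valued floor. *)
Definition varphi_plus (d : measure_display) (T : measurableType d)
    (R : realType) (P : probability T R) (n : nat)
    (X : 'I_n -> {RV P >-> R}) (p t : R) : R :=
  (Num.truncn (p * n%:R))%:R / n%:R
    + mean_cdf X (mean_quantile X (1 - p) + t) - 1.

Definition varphi_minus (d : measure_display) (T : measurableType d)
    (R : realType) (P : probability T R) (n : nat)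
    (X : 'I_n -> {RV P >-> R}) (p t : R) : R :=
  (Num.truncn (p * n%:R))%:R / n%:R
    + mean_cdf X (mean_quantile X (1 - p) - t) - 1.

(* Main.v *)
Require Import Defs.
From HB Require Import structures.
From mathcomp Require Import all_boot all_order all_algebra.
From mathcomp Require Import all_classical all_reals all_analysis.
From mathcomp Require Import measurable_realfun.
From mathcomp Require Import ring lra zify.

Set Implicit Arguments.
Unset Strict Implicit.
Unset Printing Implicit Defensive.

Import Order.TTheory GRing.Theory Num.Theory.
Import numFieldNormedType.Exports.

Local Open Scope classical_set_scope.
Local Open Scope ring_scope.

(** Whether the [j]-th largest value lies above or below a level is decided by
    how many of the variables lie above or below it, so both tail events are
    tail events of a sum of independent indicators, to which Hoeffding's
    inequality applies.  Write [j] for the floor of [p * n] and [F] for the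
    mean distribution function.

    - Upper tail at [x]: the event is that at least [j] of the variables are
      [>= x].  Since each distribution function is continuous, the mean of that
      count is at most [n * (1 - F x)] ([probability_ge_le]), so the count
      exceeds its mean by at least [j - n * (1 - F x)], which is [n] times
      [varphi_plus].
    - Lower tail at [x]: the event is that more than [n - j] of the variables
      are [<= x], while the mean of that count is exactly [n * F x].  The excess
      is at least [n - j - n * F x], which is [- n] times [varphi_minus].  It is
      nonnegative because [x] lies strictly below the quantile, whence
      [F x < 1 - p <= 1 - j / n] ([mean_cdf_lt_of_lt_quantile]).

    Hoeffding's inequality itself ([hoeffding_count]) is the Chernoff bound for
    the count [N], where [expR (s * N)] is the product of the factors
    [1 + (expR s - 1) * \1_(A i)].  The expectation of this product factorises
    because the expanded product is a linear combination of indicators of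
    intersections, whose probabilities are given by independence; each factor
    of the result is bounded by Hoeffding's lemma for a Bernoulli variable
    ([bernoulli_mgf_le]).  Counting [<= x] rather than [> x] for the lower tail
    makes this one-sided inequality, with [s >= 0], sufficient for both
    parts. *)

(** * Moment generating function of a Bernoulli variable *)

Lemma ge0_of_derive_ge0 (R : realType) (f df : R -> R) (s : R) :
  0 <= s -> f 0 = 0 ->
  (forall x : R, is_derive x 1 f (df x)) ->
  (forall x, 0 <= x -> 0 <= df x) -> 0 <= f s.
Proof.
move=> s0 f0 fdf df0.
have [|c] := MVT_segment s0 (fun x _ => fdf x).
  by apply: derivable_within_continuous => x _; exact: ex_derive.
rewrite in_itv/= f0 !subr0 => /andP[c0 _] ->.
by rewrite mulr_ge0 ?df0.
Qed.

(** Taking logarithms, the inequality says that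
    [f x = p * x + x ^+ 2 / 8 - ln (D x)] is nonnegative.  Both [f] and its
    derivative vanish at [0], and the second derivative is
    [4^-1 - u * (1 - u)], which is [(u - 2^-1) ^+ 2], where [u] is the weight of
    the value 1 under the exponentially tilted Bernoulli law. *)
Lemma bernoulli_mgf_le (R : realType) (p s : R) : 0 <= p <= 1 -> 0 <= s ->
  1 + (expR s - 1) * p <= expR (p * s + s ^+ 2 / 8).
Proof.
move=> /andP[p0 p1] s0.
pose D (x : R) := 1 + (expR x - 1) * p.
have D_gt0 x : 0 < D x.
  rewrite /D; have := expR_gt0 x; move: (expR x) => e e0.
  have [->|p_gt0] := eqVneq p 0; first by rewrite mulr0 addr0.
  have : 0 < e * p by rewrite mulr_gt0// lt_neqAle eq_sym p_gt0.
  lra.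
have dD (x : R) : is_derive x 1 D (expR x * p).
  by apply: is_derive_eq; rewrite /GRing.scale /=; ring.
pose u (x : R) := expR x * p * (D x)^-1.
pose k (x : R) := p + x / 4 - u x.
pose f (x : R) := p * x + x ^+ 2 / 8 - ln (D x).
have du (x : R) : is_derive x 1 u (u x * (1 - u x)).
  have dV := is_deriveV (lt0r_neq0 (D_gt0 x)) (dD x).
  apply: is_derive_eq; rewrite /GRing.scale/= /u.
  by field; rewrite lt0r_neq0.
have dk (x : R) : is_derive x 1 k (4^-1 - u x * (1 - u x)).
  by apply: is_derive_eq; rewrite /GRing.scale/=; ring.
have df (x : R) : is_derive x 1 f (k x).
  have dl := is_derive1_comp (is_derive1_ln (D_gt0 x)) (dD x).
  apply: is_derive_eq; rewrite /GRing.scale/= /k /u.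
  by field; rewrite lt0r_neq0.
have k_ge0 x : 0 <= x -> 0 <= k x.
  move=> x0; apply: (ge0_of_derive_ge0 x0 _ dk).
    by rewrite /k /u /D expR0; field.
  move=> y _; have := sqr_ge0 (u y - 2^-1); nra.
have : 0 <= f s.
  apply: (ge0_of_derive_ge0 s0 _ df k_ge0).
  by rewrite /f /D expR0 subrr mul0r addr0 ln1; field.
rewrite subr_ge0 => lnD_le.
by rewrite -[leLHS](lnK (D_gt0 s)) ler_expR.
Qed.

(** * Counting in a sorted sequence *)

(** In a sorted sequence the entries that satisfy a predicate closed towards
    the head form a prefix, whose length is their number. *)
Lemma sorted_nth_count (T : Type) (r : rel T) (a : pred T) (x0 : T) s i :
  transitive r -> (forall u v, r u v -> a v -> a u) ->
  sorted r s -> (i < size s)%N -> a (nth x0 s i) = (i < count a s)%N.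
Proof.
move=> r_trans a_down; elim: s i => [//|y s IH] i /= ys i_s.
have s_sorted := path_sorted ys.
case ay : (a y).
  by case: i i_s => [|i] //= i_s; rewrite IH.
have no_a : count a s = 0%N.
  apply/eqP; rewrite -leqn0 leqNgt -has_count.
  have := order_path_min r_trans ys.
  by elim: s {IH ys i_s s_sorted} => //= z s IH /andP[yz /IH/negPf ->];
    rewrite orbF; apply/negP => /(a_down _ _ yz); rewrite ay.
by case: i i_s => [|i] i_s /=; rewrite ?IH ?no_a ?ltn0.
Qed.

(** * Hoeffding's inequality for the number of events that occur *)

Section count.
Context (d : measure_display) (T : measurableType d) (R : realType)
  (P : probability T R) (n : nat) (A : 'I_n -> set T).
Hypothesis mA : forall i, measurable (A i).
Hypothesis indepA : forall J : {set 'I_n},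
  P (\bigcap_(i in [set` J]) A i) = (\prod_(i in J) P (A i))%E.

(** Expanding the product over the subsets [J] of indices yields the terms
    [c ^+ #|J|] times the indicator of the intersection over [J]; independence
    evaluates their expectations, and the same expansion, read backwards,
    reassembles the product.  The sign of [c] makes all terms nonnegative, so
    that no integrability has to be checked. *)
Lemma expectation_prod_indic (c : R) : 0 <= c ->
  (\int[P]_w (\prod_(i < n) (1 + c * \1_(A i) w))%:E =
   (\prod_(i < n) (1 + c * fine (P (A i))))%:E)%E.
Proof.
move=> c_ge0.
have PE i : P (A i) = (fine (P (A i)))%:E by rewrite fineK// fin_num_measure.
have expand (g : 'I_n -> R) : \prod_(i < n) (1 + c * g i) =
    \sum_(J : {set 'I_n}) c ^+ #|J| * \prod_(i in J) g i.
  under eq_bigr do rewrite addrC.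
  rewrite bigA_distr; apply: eq_bigr => J _.
  by rewrite -big_mkcond/= big_split/= prodr_const.
have mcap (J : {set 'I_n}) : measurable (\bigcap_(i in [set` J]) A i).
  by apply: fin_bigcap_measurable.
have indic_cap (J : {set 'I_n}) w :
    \prod_(i in J) \1_(A i) w = \1_(\bigcap_(i in [set` J]) A i) w :> R.
  rewrite !indicE; have [/set_mem JAw|nJAw] := boolP (w \in _).
    by apply: big1 => i iJ; rewrite indicE mem_set//; exact: JAw.
  move: nJAw; rewrite notin_setE => /existsNP[i /not_implyP[iJ nAw]].
  by rewrite (bigD1 i)//= indicE memNset// mul0r.
under eq_integral => w _.
  rewrite expand -sumEFin; under eq_bigr => J _ do rewrite indic_cap EFinM.
  over.
rewrite ge0_integral_sum//; last 2 first.
- move=> J; apply/measurable_EFinP.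
  by apply: measurable_funM => //; exact: measurable_indic.
- by move=> J w _; rewrite -EFinM lee_fin mulr_ge0 ?exprn_ge0.
rewrite expand -sumEFin; apply: eq_bigr => J _.
rewrite ge0_integralZl_EFin//; last 2 first.
- by apply/measurable_EFinP; exact: measurable_indic.
- by rewrite exprn_ge0.
rewrite integral_indic// setIT EFinM; congr (_ * _)%E.
rewrite -prodEFin (eq_bigr _ (fun i _ => esym (PE i))); exact: indepA.
Qed.

(** The hypothesis bounds the mean of the count from above instead of naming it,
    so that an upper bound on the individual probabilities is enough to apply
    the inequality. *)
Lemma hoeffding_count (a delta : R) : (0 < n)%N -> 0 <= delta ->
  \sum_(i < n) fine (P (A i)) + delta <= a ->
  (P [set w | (a <= \sum_(i < n) \1_(A i) w)%R]
    <= (expR (- (2 * delta ^+ 2 / n%:R)))%:E)%E.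
Proof.
move=> n_gt0.
have mN : measurable_fun setT (fun w => \sum_(i < n) \1_(A i) w : R).
  by apply: measurable_sum => i; exact: measurable_indic.
rewrite le_eqVlt => /predU1P[<- _|delta_gt0 le_a].
  (* The Chernoff bound needs [s > 0]; for [delta = 0] the claim is trivial. *)
  rewrite expr0n/= mulr0 mul0r oppr0 expR0; apply: probability_le1.
  have := mN measurableT _ (measurable_itv `[a, +oo[).
  by rewrite setTI; congr measurable; apply/seteqP;
    split => w /=; rewrite in_itv/= andbT.
have nR_gt0 : 0 < n%:R :> R by rewrite ltr0n.
pose N : {RV P >-> R} := mfun_Sub (mem_set mN).
(* The minimiser of the exponent [n * s ^+ 2 / 8 - s * delta]. *)
pose s := 4 * delta / n%:R.
have s_gt0 : 0 < s by rewrite divr_gt0 ?mulr_gt0.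
apply: (le_trans (chernoff N a s_gt0)).
have -> : 'M_P N s = (\prod_(i < n) (1 + (expR s - 1) * fine (P (A i))))%:E.
  rewrite -expectation_prod_indic; last by rewrite subr_ge0 -expR0 ler_expR ltW.
  rewrite /mmt_gen_fun unlock; apply: eq_integral => w _.
  rewrite /N /= mulrC big_distrr/= expR_sum; congr EFin.
  apply: eq_bigr => i _; rewrite indicE.
  by case: (w \in A i); rewrite ?mulr1 ?mulr0 ?expR0 ?addr0// subrKC.
rewrite -EFinM lee_fin.
have le_prod : \prod_(i < n) (1 + (expR s - 1) * fine (P (A i))) <=
    expR (s * (\sum_(i < n) fine (P (A i))) + n%:R * (s ^+ 2 / 8)).
  rewrite big_distrr/= mulr_natl -[n in _ *+ n]card_ord -sumr_const.
  rewrite -big_split/= expR_sum; apply: ler_prod => i _.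
  have P_ge0 : 0 <= fine (P (A i)) by rewrite fine_ge0.
  apply/andP; split.
    by rewrite addr_ge0// mulr_ge0// subr_ge0 -expR0 ler_expR ltW.
  have P_le1 : fine (P (A i)) <= 1.
    by rewrite -lee_fin fineK ?fin_num_measure// probability_le1.
  by rewrite [s * _]mulrC bernoulli_mgf_le ?P_ge0 ?(ltW s_gt0).
apply: (le_trans (ler_wpM2r (expR_ge0 _) le_prod)).
rewrite -expRD ler_expR.
have : s * (\sum_(i < n) fine (P (A i)) + delta) <= s * a.
  by rewrite ler_pM2l.
have -> : n%:R * (s ^+ 2 / 8) = 2 * delta ^+ 2 / n%:R.
  by rewrite /s; field; rewrite lt0r_neq0.
have : s * delta = 2 * (2 * delta ^+ 2 / n%:R).
  by rewrite /s; field; rewrite lt0r_neq0.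
by rewrite mulrDr => ->; lra.
Qed.

End count.

(** * Order statistics and the mean distribution function *)

Section order_statistics.
Context (d : measure_display) (T : measurableType d) (R : realType)
  (P : probability T R) (n : nat) (X : 'I_n -> {RV P >-> R}).

Lemma count_values_indic (I : interval R) (w : T) :
  (count (fun y => y \in I) [seq X k w | k <- enum 'I_n])%:R =
  \sum_(k < n) \1_(X k @^-1` [set` I]) w :> R.
Proof.
rewrite count_map -sum1_count big_enum_cond/= big_mkcond/= natr_sum.
apply: eq_bigr => k _; rewrite indicE.
suff -> : (w \in X k @^-1` [set` I]) = (X k w \in I) by case: ifP.
by apply/idP/idP => [/set_mem|Xkw]//; exact/mem_set.
Qed.

Let values_size (w : T) : size [seq X k w | k <- enum 'I_n] = n.
Proof. by rewrite size_map size_enum_ord. Qed.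

Let ge_trans : transitive (>=%R : rel R).
Proof. by move=> y x z /= yx zy; exact: le_trans zy yx. Qed.

Let sorted_values (w : T) :
  sorted >=%R (sort >=%R [seq X k w | k <- enum 'I_n]).
Proof. by apply: sort_sorted => x y; exact: le_total. Qed.

Lemma le_order_statE (j : nat) (x : R) (w : T) : (0 < j <= n)%N ->
  (x <= order_stat X j w) =
  (j%:R <= \sum_(k < n) \1_(X k @^-1` `[x, +oo[) w :> R).
Proof.
case: j => [//|j] /= jn; rewrite -count_values_indic ler_nat /order_stat/=.
rewrite (sorted_nth_count (a := fun y => x <= y) 0 ge_trans)//.
- by rewrite count_sort; congr leq; apply: eq_count => y; rewrite in_itv/= andbT.
- by move=> u v vu xv; exact: le_trans vu.
- by rewrite size_sort values_size.
Qed.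

(** The count of the values [> x] is the one to which [sorted_nth_count]
    applies; passing to the complement turns at most [j - 1] of them into at
    least [n - j + 1] values [<= x]. *)
Lemma order_stat_leE (j : nat) (x : R) (w : T) : (0 < j <= n)%N ->
  (order_stat X j w <= x) =
  ((n - j).+1%:R <= \sum_(k < n) \1_(X k @^-1` `]-oo, x]) w :> R).
Proof.
case: j => [//|j] /= jn; rewrite -count_values_indic ler_nat /order_stat/=.
rewrite leNgt (sorted_nth_count (a := fun y => x < y) 0 ge_trans)//.
- rewrite count_sort -leqNgt.
  have := count_predC (fun y => x < y) [seq X k w | k <- enum 'I_n].
  rewrite values_size.
  rewrite (eq_count (a1 := predC _) (a2 := fun y => y \in `]-oo, x])).
    move: (count _ _) (count _ _) => u v; lia.
  by move=> y /=; rewrite in_itv/= leNgt.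
- by move=> u v vu xv; exact: lt_le_trans vu.
- by rewrite size_sort values_size.
Qed.

Lemma sum_cdfE (x : R) : (0 < n)%N ->
  \sum_(k < n) fine (cdf (X k) x) = n%:R * mean_cdf X x.
Proof. by move=> n0; rewrite mulrA divff ?mul1r// pnatr_eq0 -lt0n. Qed.

Lemma mean_cdf_nondecreasing : {homo mean_cdf X : x y / x <= y}.
Proof.
move=> x y xy; rewrite ler_wpM2l ?invr_ge0//; apply: ler_sum => k _.
by rewrite fine_le ?fin_num_measure// cdf_nondecreasing.
Qed.

Lemma cvg_mean_cdfNy0 : mean_cdf X x @[x --> -oo] --> 0.
Proof.
rewrite -[X in _ --> X](mulr0 n%:R^-1).
apply: cvgM; first exact: cvg_cst.
rewrite [X in _ --> X](_ : 0 = \sum_(k < n) 0); last by rewrite big1.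
apply: (cvg_big (@add_continuous R)) => k _.
exact: (fine_cvg (cvg_cdfNy0 (X k))).
Qed.

(** The set whose infimum defines the quantile must be bounded from below, since
    otherwise the infimum takes a default value; the bound comes from
    [mean_cdf X] tending to [0] at [-oo]. *)
Lemma mean_cdf_lt_of_lt_quantile (q x : R) : 0 < q ->
  x < mean_quantile X q -> mean_cdf X x < q.
Proof.
move=> q_gt0; apply: contraTT; rewrite -!leNgt => q_le.
apply: ge_inf => //.
have [b b_lt] := filter_ex (cvgr_lt _ cvg_mean_cdfNy0 _ q_gt0).
exists b => y /= q_y; rewrite leNgt; apply/negP => yb.
have := lt_le_trans b_lt (le_trans q_y (mean_cdf_nondecreasing (ltW yb))).
by rewrite ltxx.
Qed.

End order_statistics.

(** For every [y < x] the events [Y <= y] and [Y >= x] are disjoint, so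
    [cdf Y y] is at most the complementary probability; left continuity at [x]
    extends this to [y = x]. *)
Lemma probability_ge_le (d : measure_display) (T : measurableType d)
    (R : realType) (P : probability T R) (Y : {RV P >-> R}) (x : R) :
  {for x, continuous (cdf Y)} ->
  fine (P (Y @^-1` `[x, +oo[)) <= 1 - fine (cdf Y x).
Proof.
move=> cY.
have mge : measurable (Y @^-1` `[x, +oo[).
  by rewrite -[_ @^-1` _]setTI; exact: measurable_funPT.
suff : (cdf Y x <= 1 - P (Y @^-1` `[x, +oo[))%E.
  rewrite -lee_fin EFinB !fineK ?fin_num_measure//.
  by rewrite leeBrDl ?fin_num_measure// leeBrDl ?fin_num_measure// addeC.
apply: (cvge_le (F := x^'-) (f := cdf Y)); last exact: cvg_at_left_filter cY.
near=> y.
have yx : y < x by near: y; exact: nbhs_left_lt.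
rewrite -probability_setC// /cdf /distribution /pushforward.
apply: le_measure; rewrite ?inE.
- by rewrite -[_ @^-1` _]setTI; exact: measurable_funPT.
- exact: measurableC.
- move=> w /=; rewrite !in_itv/= andbT => Yy; apply/negP; rewrite -ltNge.
  exact: le_lt_trans yx.
Unshelve. all: by end_near.
Qed.

(** * Tail bounds for the percentile *)

Section percentile.
Context (d : measure_display) (T : measurableType d) (R : realType)
  (P : probability T R) (n : nat) (X : 'I_n -> {RV P >-> R}).
Hypothesis indepX : independent_RVs X.

Lemma hoeffding_preimages (I : interval R) (a delta : R) :
  (0 < n)%N -> 0 <= delta ->
  \sum_(k < n) fine (P (X k @^-1` [set` I])) + delta <= a ->
  (P [set w | (a <= \sum_(k < n) \1_(X k @^-1` [set` I]) w)%R]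
    <= (expR (- (2 * delta ^+ 2 / n%:R)))%:E)%E.
Proof.
apply: hoeffding_count => [k|J].
  by rewrite -[_ @^-1` _]setTI; exact: measurable_funPT.
exact: (indepX (B := fun=> [set` I])).
Qed.

End percentile.

Theorem theorem2 (d : measure_display) (T : measurableType d)
    (R : realType) (P : probability T R) (n : nat)
    (X : 'I_n -> {RV P >-> R})
    (indepX : independent_RVs X)
    (contX : forall k : 'I_n, continuous (cdf (X k)))
    (p : R) (p_gt0 : 0 < p) (p_lt1 : p < 1) (pn_ge1 : 1 <= p * n%:R) :
  (forall t : R, 0 < t -> 0 <= varphi_plus X p t ->
    (P [set w | (mean_quantile X (1 - p) + t
                  <= order_stat X (Num.truncn (p * n%:R)) w)%R]
      <= (expR (- (2 * n%:R * (varphi_plus X p t) ^+ 2)))%:E)%E) /\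
  (forall t : R, 0 < t ->
    (P [set w | (order_stat X (Num.truncn (p * n%:R)) w
                  <= mean_quantile X (1 - p) - t)%R]
      <= (expR (- (2 * n%:R * (varphi_minus X p t) ^+ 2)))%:E)%E).
Proof.
set j := Num.truncn (p * n%:R).
have n_gt0 : (0 < n)%N.
  by rewrite lt0n; apply: contraTneq pn_ge1 => ->; rewrite mulr0 ler10.
have nR_gt0 : 0 < n%:R :> R by rewrite ltr0n.
have j_le : j%:R <= p * n%:R by rewrite truncn_le// mulr_ge0 ?ltW.
have j_bounds : (0 < j <= n)%N.
  rewrite truncn_gt0 pn_ge1/= -(ler_nat R); apply: le_trans j_le _.
  by rewrite ler_piMl// ltW.
have expE (x : R) : 2 * (n%:R * x) ^+ 2 / n%:R = 2 * n%:R * x ^+ 2.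
  by field; rewrite lt0r_neq0.
have jE : n%:R * (j%:R / n%:R) = j%:R :> R by field; rewrite lt0r_neq0.
split=> t t_gt0.
- rewrite /varphi_plus; set x := _ + t => phi_ge0.
  under eq_set => w do rewrite (le_order_statE _ _ _ j_bounds).
  rewrite -expE; apply: hoeffding_preimages => //.
    by rewrite mulr_ge0.
  have : \sum_(k < n) fine (P (X k @^-1` `[x, +oo[)) <=
      \sum_(k < n) (1 - fine (cdf (X k) x)).
    by apply: ler_sum => k _; apply: probability_ge_le; exact: contX.
  rewrite sumrB sumr_const card_ord sum_cdfE// mulrBr mulrDr jE mulr1.
  lra.
- rewrite /varphi_minus; set x := _ - t.
  have F_lt : mean_cdf X x < 1 - p.
    apply: mean_cdf_lt_of_lt_quantile; first by rewrite subr_gt0.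
    by rewrite ltrBlDr ltrDl.
  under eq_set => w do rewrite (order_stat_leE _ _ _ j_bounds).
  rewrite -sqrrN -expE; apply: hoeffding_preimages => //.
    rewrite mulr_ge0// oppr_ge0.
    have : j%:R / n%:R <= p by rewrite ler_pdivrMr.
    lra.
  rewrite sum_cdfE// mulrN mulrBr mulrDr jE mulr1 -natr1 natrB.
    lra.
  by case/andP: j_bounds.
Qed.
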